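(* Let $(X,d)$ be a metric space and let $M$ be a closed nonempty proper subset of $X$. Let $F:(X\setminus M,d)\to(0,\infty)$ be a $1$-Lipschitz function. Let $c>0$. Then the function $$h_c(x,y)=\log\left(1+c\,\frac{d(x,y)}{\sqrt{F(x)F(y)}}\right),\qquad x,y\in X\setminus M,$$ satisfies the Gromov hyperbolicity condition with a Gromov constant $\delta\le\log\left(2+\frac1c\right)$.
   Context: $\log$ is the natural logarithm. $F$ is $1$-Lipschitz if $|F(x)-F(y)|\le d(x,y)$ for all $x,y\in X\setminus M$. A function $\rho:S\times S\to[0,\infty)$ (not necessarily a metric) satisfies the Gromov hyperbolicity condition with Gromov constant $\delta\ge0$ if for all $x,y,z,w\in S$ $$\rho(x,z)+\rho(y,w)\le\max\{\rho(x,w)+\rho(y,z),\ \rho(x,y)+\rho(z,w)\}+2\delta .$$ *)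

(* Defs.v *)
From mathcomp Require Import all_boot all_order all_algebra.
From mathcomp Require Import all_classical all_reals all_analysis.

Set Implicit Arguments.
Unset Strict Implicit.
Unset Printing Implicit Defensive.

Import Order.TTheory GRing.Theory Num.Theory.
Local Open Scope classical_set_scope.
Local Open Scope ring_scope.

(* Functions whose domain is a subset [S] of [X] are represented by functions
   that are total on [X] and constrained on [S] only. *)

(* The library's [k.-lipschitz_A f] requires normed modules, hence this version
   for metric spaces. *)
Definition one_lipschitz_on (R : realType) (X : metricType R) (S : set X)
    (F : X -> R) : Prop :=
  forall x y, S x -> S y -> `|F x - F y| <= mdist x y.

(* The first two conjuncts express that [rho] takes its values in [0, +oo[ on
   [S] and that a Gromov constant is nonnegative. *)
Definition gromov_hyperbolic_on (R : realType) (T : Type) (S : set T)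
    (rho : T -> T -> R) (delta : R) : Prop :=
  [/\ forall x y, S x -> S y -> 0 <= rho x y,
      0 <= delta &
      forall x y z w, S x -> S y -> S z -> S w ->
        rho x z + rho y w <=
          Num.max (rho x w + rho y z) (rho x y + rho z w) + 2 * delta].

Definition hc (R : realType) (X : metricType R) (F : X -> R) (c : R)
    (x y : X) : R :=
  ln (1 + c * (mdist x y / Num.sqrt (F x * F y))).

(* Main.v *)
Require Import Defs.
From mathcomp Require Import all_boot all_order all_algebra.
From mathcomp Require Import all_classical all_reals all_analysis.
From mathcomp Require Import ring lra.

Set Implicit Arguments.
Unset Strict Implicit.
Unset Printing Implicit Defensive.

Import Order.TTheory GRing.Theory Num.Theory.
Local Open Scope classical_set_scope.
Local Open Scope ring_scope.

(** Multiplying [exp (hc F c x y) = 1 + c * (d(x,y) / sqrt (F x * F y))] by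
    [sqrt (F x * F y)] gives the kernel
    [a(x,y) = sqrt (F x) * sqrt (F y) + c * d(x,y)].  In the four-point
    condition each of the three pairings of [x, y, z, w] involves every point
    once, so the normalising factors cancel, and the condition for [hc F c]
    with constant [ln K] becomes
    [a(x,z) * a(y,w) <= K^2 * max (a(x,w) * a(y,z)) (a(x,y) * a(z,w))].

    This Ptolemy-like inequality holds for every symmetric nonnegative kernel
    such that [a(x,z) <= K * max (a(x,y)) (a(y,z))]
    ([four_point_of_quasi_ultrametric]), and the kernel at hand has that
    property with [K = 2 + 1/c] ([hc_kernel_quasi_ultrametric]): the distance
    part of [a(x,z)] is controlled by the triangle inequality, and the part
    [sqrt (F x) * sqrt (F z)] by a comparison of [F y] with [F x] and [F z],
    the Lipschitz bound being used when [F y] is the smallest of the three. *)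

(** Let [xy] be a shortest edge of the quadrilateral [xyzw].  The path from [x]
    to [z] through [y] and the path from [y] to [w] through [x] both use this
    edge, so the diagonals are at most [K] times the remaining edges [yz] and
    [xw] of these paths, which are opposite.  The other three positions of a
    shortest edge are relabellings of this one. *)
Lemma four_point_of_quasi_ultrametric (R : realFieldType) (T : Type)
    (S : set T) (a : T -> T -> R) (K : R) :
  (forall x y, S x -> S y -> 0 <= a x y) ->
  (forall x y, a x y = a y x) ->
  (forall x y z, S x -> S y -> S z -> a x z <= K * Num.max (a x y) (a y z)) ->
  forall x y z w, S x -> S y -> S z -> S w ->
    a x z * a y w <= K ^+ 2 * Num.max (a x w * a y z) (a x y * a z w).
Proof.
move=> a_ge0 aC aK.
have shortest_edge x y z w : S x -> S y -> S z -> S w ->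
    a x y <= a y z -> a x y <= a x w ->
    a x z * a y w <= K ^+ 2 * (a x w * a y z).
  move=> Sx Sy Sz Sw xy_yz xy_xw.
  rewrite [leRHS](_ : _ = (K * a y z) * (K * a x w)); last by ring.
  apply: ler_pM; try exact: a_ge0.
    by have := aK x y z Sx Sy Sz; rewrite max_r.
  by have := aK y x w Sy Sx Sw; rewrite (aC y x) max_r.
move=> x y z w Sx Sy Sz Sw.
have K2_max p q r : p <= K ^+ 2 * q \/ p <= K ^+ 2 * r ->
    p <= K ^+ 2 * Num.max q r.
  by rewrite maxr_pMr ?sqr_ge0// le_max => -[] ->; rewrite ?orbT.
apply: K2_max.
have := shortest_edge x y z w Sx Sy Sz Sw.
have := shortest_edge z w x y Sz Sw Sx Sy.
have := shortest_edge y z w x Sy Sz Sw Sx.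
have := shortest_edge x w z y Sx Sw Sz Sy.
rewrite (aC z x) (aC w y) (aC z y) (aC w x) (aC y x) (aC w z).
rewrite (mulrC (a y z)) (mulrC (a y w)).
move=> min_xw min_yz min_zw min_xy.
(* Opposite edges need not be compared: [shortest_edge] only asks for an edge
   that is at most both of its neighbours. *)
case: (leP (a x y) (a y z)) => ?; case: (leP (a x y) (a x w)) => ?;
  case: (leP (a z w) (a y z)) => ?; case: (leP (a z w) (a x w)) => ?;
  first [ by left; apply: min_xy; lra | by left; apply: min_zw; lra
        | by right; apply: min_yz; lra | by right; apply: min_xw; lra ].
Qed.

Definition hc_kernel (R : realType) (X : metricType R) (F : X -> R) (c : R)
    (x y : X) : R :=
  Num.sqrt (F x) * Num.sqrt (F y) + c * mdist x y.

Lemma hc_kernel_gt0 (R : realType) (X : metricType R) (F : X -> R) (c : R)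
    (x y : X) :
  0 < F x -> 0 < F y -> 0 < c -> 0 < hc_kernel F c x y.
Proof.
move=> Fx Fy c_gt0.
by rewrite ltr_pwDl ?mulr_gt0 ?sqrtr_gt0// mulr_ge0 ?mdist_ge0 ?ltW.
Qed.

(** The denominator becomes a sum of one-point terms, which cancel in the
    four-point condition. *)
Lemma hcE (R : realType) (X : metricType R) (F : X -> R) (c : R) (x y : X) :
  0 < F x -> 0 < F y -> 0 < c ->
  hc F c x y =
    ln (hc_kernel F c x y) - ln (Num.sqrt (F x)) - ln (Num.sqrt (F y)).
Proof.
move=> Fx Fy c_gt0; rewrite /hc sqrtrM ?ltW//.
have sx : 0 < Num.sqrt (F x) by rewrite sqrtr_gt0.
have sy : 0 < Num.sqrt (F y) by rewrite sqrtr_gt0.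
have a_gt0 := hc_kernel_gt0 Fx Fy c_gt0.
rewrite -addrA -opprD -lnM ?posrE// -ln_div ?posrE ?mulr_gt0//.
congr ln; rewrite /hc_kernel; field.
by rewrite !gt_eqF.
Qed.

(** Let [u] be the maximum on the right.  The distance part of [a(x,z)] is at
    most [c * d(x,y) + c * d(y,z)].  If [F y] is at least [F x] or [F z], then
    replacing that value by [F y] bounds [sqrt (F x) * sqrt (F z)] by the
    square-root part of [a(y,z)] or [a(x,y)], and [a(x,z) <= 2 * u].  Otherwise,
    if for instance [F x] is the largest value,
    [sqrt (F x) * sqrt (F z) <= F x <= F y + d(x,y)
     <= sqrt (F x) * sqrt (F y) + d(x,y)],
    where [d(x,y) <= u / c]; this last term is the [c^-1] in the constant. *)
Lemma hc_kernel_quasi_ultrametric (R : realType) (X : metricType R) (S : set X)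
    (F : X -> R) (c : R) (x y z : X) :
  (forall x, S x -> 0 < F x) -> one_lipschitz_on S F -> 0 < c ->
  S x -> S y -> S z ->
  hc_kernel F c x z <=
    (2 + c^-1) * Num.max (hc_kernel F c x y) (hc_kernel F c y z).
Proof.
move=> F_gt0 F_lip c_gt0 Sx Sy Sz; rewrite /hc_kernel.
set u := Num.max _ _.
have : Num.sqrt (F x) * Num.sqrt (F y) + c * mdist x y <= u.
  by rewrite le_max lexx.
have : Num.sqrt (F y) * Num.sqrt (F z) + c * mdist y z <= u.
  by rewrite le_max lexx orbT.
move: u => u yz_u xy_u.
have tri : c * mdist x z <= c * mdist x y + c * mdist y z.
  by rewrite -mulrDr ler_pM2l// metric_triangle.
have xy_ge0 : 0 <= mdist x y := mdist_ge0 x y.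
have yz_ge0 : 0 <= mdist y z := mdist_ge0 y z.
have cxy_ge0 : 0 <= c * mdist x y by rewrite mulr_ge0// ltW.
have cyz_ge0 : 0 <= c * mdist y z by rewrite mulr_ge0// ltW.
have lip_xy : F x - F y <= mdist x y.
  by apply: le_trans (F_lip x y Sx Sy); exact: ler_norm.
have lip_yz : F z - F y <= mdist y z.
  by rewrite metric_sym; apply: le_trans (F_lip z y Sz Sy); exact: ler_norm.
have sq p : S p -> F p = Num.sqrt (F p) * Num.sqrt (F p).
  by move=> Sp; rewrite -expr2 sqr_sqrtr// ltW// F_gt0.
have s_gt0 p : S p -> 0 < Num.sqrt (F p) by move=> ?; rewrite sqrtr_gt0 F_gt0.
rewrite (sq x Sx) (sq y Sy) in lip_xy; rewrite (sq z Sz) (sq y Sy) in lip_yz.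
move: (s_gt0 x Sx) (s_gt0 y Sy) (s_gt0 z Sz) yz_u xy_u lip_xy lip_yz.
move: (Num.sqrt (F x)) (Num.sqrt (F y)) (Num.sqrt (F z)) => s t r.
move=> s_gt0' t_gt0 r_gt0 yz_u xy_u lip_xy lip_yz.
have st_ge0 : 0 <= s * t by rewrite mulr_ge0 ?ltW.
have tr_ge0 : 0 <= t * r by rewrite mulr_ge0 ?ltW.
have div_c p : c * p <= u -> p <= c^-1 * u.
  by move=> cp_u; rewrite mulrC ler_pdivlMr// mulrC.
have xy_u' : mdist x y <= c^-1 * u by apply: div_c; lra.
have yz_u' : mdist y z <= c^-1 * u by apply: div_c; lra.
rewrite mulrDl.
have [s_le_t|t_lt_s] := leP s t.
  have : s * r <= t * r by rewrite ler_pM2r.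
  lra.
have [r_le_t|t_lt_r] := leP r t.
  have : s * r <= s * t by rewrite ler_pM2l.
  lra.
(* Now [F y] is smaller than both [F x] and [F z]. *)
have [s_le_r|r_lt_s] := leP s r.
  have : s * r <= r * r by rewrite ler_pM2r.
  have : t * t <= t * r by rewrite ler_pM2l// ltW.
  lra.
have : s * r <= s * s by rewrite ler_pM2l// ltW.
have : t * t <= s * t by rewrite ler_pM2r// ltW.
lra.
Qed.

Theorem theorem10 (R : realType) (X : metricType R) (M : set X)
  (M_closed : closed M) (M_nonempty : M !=set0) (M_proper : M `<` [set: X])
  (F : X -> R) (F_pos : forall x, (~` M) x -> 0 < F x)
  (F_lip : one_lipschitz_on (~` M) F) (c : R) (c_pos : 0 < c) :
  exists2 delta : R, delta <= ln (2 + c^-1) &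
    gromov_hyperbolic_on (~` M) (hc F c) delta.
Proof.
have K_ge1 : 1 <= 2 + c^-1.
  have : 0 < c^-1 by rewrite invr_gt0.
  lra.
have K_gt0 : 0 < 2 + c^-1 by apply: lt_le_trans K_ge1.
exists (ln (2 + c^-1)) => //; split.
- move=> x y Sx Sy; rewrite /hc ln_ge0// lerDl mulr_ge0 ?(ltW c_pos)//.
  by rewrite divr_ge0 ?mdist_ge0 ?sqrtr_ge0.
- exact: ln_ge0.
move=> x y z w Sx Sy Sz Sw.
have a_gt0 p q : (~` M) p -> (~` M) q -> 0 < hc_kernel F c p q.
  by move=> /F_pos Fp /F_pos Fq; exact: hc_kernel_gt0.
have aC p q : hc_kernel F c p q = hc_kernel F c q p.
  by rewrite /hc_kernel metric_sym mulrC.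
have := @four_point_of_quasi_ultrametric _ _ _ _ _
  (fun p q Sp Sq => ltW (a_gt0 p q Sp Sq)) aC
  (fun p q r Sp Sq Sr =>
     hc_kernel_quasi_ultrametric F_pos F_lip c_pos Sp Sq Sr)
  x y z w Sx Sy Sz Sw.
have ln_four_point p q r s : 0 < p -> 0 < q -> 0 < r -> 0 < s ->
    p * q <= (2 + c^-1) ^+ 2 * (r * s) ->
    ln p + ln q <= ln r + ln s + 2 * ln (2 + c^-1).
  move=> p0 q0 r0 s0 le_pq.
  rewrite mulrDl !mul1r addrC -!lnM ?posrE ?mulr_gt0//.
  by rewrite ler_ln ?posrE ?mulr_gt0// mulrC (le_trans le_pq)// expr2 mulrC.
rewrite maxr_pMr ?sqr_ge0// le_max !hcE ?F_pos// -lerBlDr le_max => le_prod.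
apply/orP; case/orP: le_prod => /ln_four_point ln_le; [left|right].
  by have := ln_le (a_gt0 _ _ Sx Sz) (a_gt0 _ _ Sy Sw)
    (a_gt0 _ _ Sx Sw) (a_gt0 _ _ Sy Sz); lra.
by have := ln_le (a_gt0 _ _ Sx Sz) (a_gt0 _ _ Sy Sw)
  (a_gt0 _ _ Sx Sy) (a_gt0 _ _ Sz Sw); lra.
Qed.
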